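(* Let $G$ be a countable linear sofic group. Then there exist a non-principal ultrafilter $\omega$ on $\mathbb{N}$, a sequence $n_k\to\infty$ and an injective group morphism $\Theta:G\to\prod_{k\to\omega}GL_{n_k}(\mathbb{Q})/d_\omega$.
   Context: For a field $F$ and $a\in M_n(F)$, $\rho(a)=\operatorname{rk}(a)/n$. $\prod_{k\to\omega}GL_{n_k}(F)/d_\omega$ is the quotient of $\prod_kGL_{n_k}(F)$ by $\{(a_k)_k:\lim_{k\to\omega}\rho(a_k-\mathrm{Id})=0\}$. A countable group is linear sofic if it admits an injective group morphism into $\prod_{k\to\omega}GL_{n_k}(\mathbb{C})/d_\omega$ for some non-principal ultrafilter $\omega$ and $n_k\to\infty$. *)

(* Defs.v *)
From HB Require Import structures.
From Stdlib Require Import Reals Lra Psatz ClassicalEpsilon FunctionalExtensionality.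
From mathcomp Require Import all_boot all_order all_algebra.

Set Implicit Arguments.
Unset Strict Implicit.
Unset Printing Implicit Defensive.

Local Open Scope R_scope.

Record complexR := Cplx { Re_c : R; Im_c : R }.

Definition complexR_eqb (x y : complexR) : bool :=
  if excluded_middle_informative (x = y) then true else false.

Lemma complexR_eqP : Equality.axiom complexR_eqb.
Proof.
move=> x y; rewrite /complexR_eqb.
case: (excluded_middle_informative (x = y)) => h; [by constructor | by constructor].
Qed.

HB.instance Definition _ := hasDecEq.Build complexR complexR_eqP.

Definition complexR_find (P : pred complexR) (n : nat) : option complexR :=
  match excluded_middle_informative (exists x, P x) with
  | left h => Some (proj1_sig (constructive_indefinite_description _ h))
  | right _ => None
  end.

Lemma complexR_find_correct (P : pred complexR) n x :
  complexR_find P n = Some x -> P x.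
Proof.
rewrite /complexR_find.
case: (excluded_middle_informative _) => // h [<-].
exact: proj2_sig (constructive_indefinite_description _ h).
Qed.

Lemma complexR_find_complete (P : pred complexR) :
  (exists x, P x) -> exists n, complexR_find P n.
Proof.
move=> h; exists 0%N; rewrite /complexR_find.
by case: (excluded_middle_informative _).
Qed.

Lemma complexR_find_ext (P Q : pred complexR) :
  P =1 Q -> complexR_find P =1 complexR_find Q.
Proof.
move=> PQ n; have -> : P = Q by apply: functional_extensionality.
by [].
Qed.

HB.instance Definition _ :=
  hasChoice.Build complexR complexR_find_correct complexR_find_complete
    complexR_find_ext.

Definition c_zero : complexR := Cplx 0 0.
Definition c_one : complexR := Cplx 1 0.
Definition c_add (x y : complexR) : complexR :=
  Cplx (Re_c x + Re_c y) (Im_c x + Im_c y).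
Definition c_opp (x : complexR) : complexR := Cplx (- Re_c x) (- Im_c x).
Definition c_mul (x y : complexR) : complexR :=
  Cplx (Re_c x * Re_c y - Im_c x * Im_c y) (Re_c x * Im_c y + Im_c x * Re_c y).
Definition c_inv (x : complexR) : complexR :=
  let d := (Re_c x * Re_c x + Im_c x * Im_c x) in
  Cplx (Re_c x / d) (- Im_c x / d).

Lemma c_ext (a b c d : R) : a = c -> b = d -> Cplx a b = Cplx c d.
Proof. by move=> -> ->. Qed.

Lemma c_addA : associative c_add.
Proof. by move=> [a b] [c d] [e f]; apply: c_ext => /=; ring. Qed.
Lemma c_addC : commutative c_add.
Proof. by move=> [a b] [c d]; apply: c_ext => /=; ring. Qed.
Lemma c_add0 : left_id c_zero c_add.
Proof. by move=> [a b]; apply: c_ext => /=; ring. Qed.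
Lemma c_addN : left_inverse c_zero c_opp c_add.
Proof. by move=> [a b]; apply: c_ext => /=; ring. Qed.

HB.instance Definition _ :=
  GRing.isZmodule.Build complexR c_addA c_addC c_add0 c_addN.

Lemma c_mulA : associative c_mul.
Proof. by move=> [a b] [c d] [e f]; apply: c_ext => /=; ring. Qed.
Lemma c_mulC : commutative c_mul.
Proof. by move=> [a b] [c d]; apply: c_ext => /=; ring. Qed.
Lemma c_mul1 : left_id c_one c_mul.
Proof. by move=> [a b]; apply: c_ext => /=; ring. Qed.
Lemma c_mulDl : left_distributive c_mul c_add.
Proof. by move=> [a b] [c d] [e f]; apply: c_ext => /=; ring. Qed.
Lemma c_one_neq0 : c_one != (c_zero : complexR).
Proof.
apply/eqP => -[h]; exact: R1_neq_R0 h.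
Qed.

HB.instance Definition _ :=
  GRing.Zmodule_isComNzRing.Build complexR c_mulA c_mulC c_mul1 c_mulDl
    c_one_neq0.

Lemma c_mulV (x : complexR) : x != 0%R -> c_mul (c_inv x) x = c_one.
Proof.
case: x => a b /eqP nz.
have hd : (a * a + b * b) <> 0.
  move=> h; apply: nz; rewrite /GRing.zero /=.
  have ha : a = 0 by nra.
  have hb : b = 0 by nra.
  by rewrite ha hb.
by apply: c_ext => /=; field.
Qed.

Lemma c_inv0 : c_inv (0%R : complexR) = 0%R.
Proof. by apply: c_ext => /=; rewrite /Rdiv; ring. Qed.

HB.instance Definition _ := GRing.ComNzRing_isField.Build complexR c_mulV c_inv0.

Local Close Scope R_scope.
Local Open Scope ring_scope.

Definition is_ultrafilter (U : (nat -> Prop) -> Prop) : Prop :=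
  [/\ U (fun _ => True),
      ~ U (fun _ => False),
      (forall A B : nat -> Prop, U A -> (forall k, A k -> B k) -> U B),
      (forall A B : nat -> Prop, U A -> U B -> U (fun k => A k /\ B k))
    & (forall A : nat -> Prop, U A \/ U (fun k => ~ A k))].

Definition non_principal (U : (nat -> Prop) -> Prop) : Prop :=
  forall m : nat, ~ U (fun k => k = m).

Definition tends_to_infty (n : nat -> nat) : Prop :=
  forall N : nat, exists K : nat, forall k, (K <= k)%N -> (N <= n k)%N.

Definition rho (F : fieldType) (n : nat) (a : 'M[F]_n) : rat :=
  (\rank a)%:R / n%:R.

(* lim_{k→ω} x_k = 0, for a sequence of nonnegative rationals *)
Definition ulim_zero (U : (nat -> Prop) -> Prop) (x : nat -> rat) : Prop :=
  forall eps : rat, 0 < eps -> U (fun k => x k < eps).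

Definition in_GL_prod (F : fieldType) (n : nat -> nat)
    (a : forall k, 'M[F]_(n k)) : Prop :=
  forall k, a k \in unitmx.

Definition in_kernel_dw (F : fieldType) (U : (nat -> Prop) -> Prop)
    (n : nat -> nat) (a : forall k, 'M[F]_(n k)) : Prop :=
  ulim_zero U (fun k => rho (a k - 1%:M)).

(* Equality in the quotient ∏ GL_{n_k}(F) / N: a N = b N iff b^{-1} a ∈ N. *)
Definition dw_equiv (F : fieldType) (U : (nat -> Prop) -> Prop)
    (n : nat -> nat) (a b : forall k, 'M[F]_(n k)) : Prop :=
  in_kernel_dw U (fun k => invmx (b k) *m a k).

(* An injective group morphism Θ : G → ∏_{k→ω} GL_{n_k}(F)/d_ω, given
   through a lift Θ~ : G → ∏_k GL_{n_k}(F) (Θ(g) = class of Θ~(g)). *)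
Definition injective_morphism_to_ultraproduct (F : fieldType) (G : groupType)
    (U : (nat -> Prop) -> Prop) (n : nat -> nat)
    (Theta : G -> forall k, 'M[F]_(n k)) : Prop :=
  [/\ (forall g, in_GL_prod (Theta g)),
      (forall g h : G, dw_equiv U (Theta (g * h)%g)
                                (fun k => Theta g k *m Theta h k))
    & (forall g h : G, dw_equiv U (Theta g) (Theta h) -> g = h)].

Definition embeds_in_metric_ultraproduct (F : fieldType) (G : groupType) : Prop :=
  exists (U : (nat -> Prop) -> Prop) (n : nat -> nat)
         (Theta : G -> forall k, 'M[F]_(n k)),
    [/\ is_ultrafilter U, non_principal U, tends_to_infty n
      & @injective_morphism_to_ultraproduct F G U n Theta].

Definition countable_type (T : Type) : Prop :=
  exists f : T -> nat, injective f.

Definition linear_sofic (G : groupType) : Prop :=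
  embeds_in_metric_ultraproduct complexR G.

(* Main.v *)
Require Import Defs.
From HB Require Import structures.
From mathcomp Require Import all_boot all_order all_algebra all_field.
From mathcomp Require Import boolp Rstruct.

(** Every finite subset of a field [L] of characteristic zero lies in a subring
    [S] of [L] with a unital ring morphism [S -> M_d(rat)], [d > 0].  Indeed it
    lies in a finitely generated subfield, built by simple extensions [K(x)/K]:
    if [x] is algebraic, [K(x)] acts on itself by multiplication; if [x] is
    transcendental, evaluate it at a point of [K] avoiding finitely many
    denominators.  Applied blockwise to [M_n], such a morphism multiplies the
    rank of a matrix by [d] as soon as [S] contains the entries of a
    factorization [C * pid_mx r * R] with [C], [R] invertible and of the
    inverses of [C] and [R]; hence it preserves [rho].  Doing this at each index
    [k] for larger and larger finite parts of the group keeps all limits along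
    the same ultrafilter. *)

Set Implicit Arguments.
Unset Strict Implicit.
Unset Printing Implicit Defensive.
Import GRing.Theory.
Local Open Scope ring_scope.

(** * Ring morphisms defined on a subring *)

(** [f] is a total function with arbitrary values outside the subring [S], so that no subtype has to
    be built for each subring. *)
Record partial_rmorphism (R R' : pzRingType) (S : R -> Prop) (f : R -> R')
    : Prop :=
  PartialRMorphism {
    prm_in1 : S 1;
    prm_inB : forall x y, S x -> S y -> S (x - y);
    prm_inM : forall x y, S x -> S y -> S (x * y);
    prm1 : f 1 = 1;
    prmB : forall x y, S x -> S y -> f (x - y) = f x - f y;
    prmM : forall x y, S x -> S y -> f (x * y) = f x * f y }.

Section PartialRMorphismTheory.
Variables (R R' : pzRingType) (S : R -> Prop) (f : R -> R').
Hypothesis Sf : partial_rmorphism S f.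

Lemma prm_in0 : S 0.
Proof. by rewrite -(subrr 1); apply: (prm_inB Sf); apply: (prm_in1 Sf). Qed.

Lemma prm0 : f 0 = 0.
Proof. by rewrite -[0 in LHS](subrr 0) (prmB Sf) ?subrr //; apply: prm_in0. Qed.

Lemma prm_inD x y : S x -> S y -> S (x + y).
Proof.
move=> Sx Sy; rewrite -[y]opprK; apply: (prm_inB Sf) => //.
by rewrite -sub0r; apply: (prm_inB Sf) => //; apply: prm_in0.
Qed.

Lemma prmD x y : S x -> S y -> f (x + y) = f x + f y.
Proof.
move=> Sx Sy; have S0 := prm_in0.
have SNy : S (- y) by rewrite -sub0r; apply: (prm_inB Sf).
rewrite -[in LHS](opprK y) (prmB Sf) // -[- y]sub0r (prmB Sf) //.
by rewrite prm0 sub0r opprK.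
Qed.

Lemma prm_sum (I : finType) (F : I -> R) :
  (forall i, S (F i)) -> S (\sum_i F i) /\ f (\sum_i F i) = \sum_i f (F i).
Proof.
move=> SF; elim/big_ind2: _ => [|x x' y y' [Sx <-] [Sx' <-]|i _].
- by split; [apply: prm_in0 | apply: prm0].
- by split; [apply: prm_inD | apply: prmD].
- by [].
Qed.

End PartialRMorphismTheory.

(** * Blockwise extension to matrices and its effect on the rank *)

Definition blockwise (R K : pzRingType) d (f : R -> 'M[K]_d) n (A : 'M[R]_n) :
    'M[K]_(\sum_(i < n) d) :=
  \mxblock_(i, j) f (A i j).

Section Blockwise.
Variables (R K : pzRingType) (d : nat) (S : R -> Prop) (f : R -> 'M[K]_d) (n : nat).
Hypothesis Sf : partial_rmorphism S f.

Lemma blockwise_diag (v : 'rV[R]_n) :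
  blockwise f (diag_mx v) = \mxdiag_i f (v 0 i).
Proof.
rewrite /mxdiag; apply: eq_mxblock => i j; rewrite mxE.
have [->|nij] := eqVneq i j; first by rewrite conform_mx_id mulr1n.
by rewrite mulr0n (prm0 Sf).
Qed.

Lemma blockwise_prm :
  partial_rmorphism (fun A : 'M[R]_n => forall i j, S (A i j))
    (blockwise f (n:=n)).
Proof.
split=> [i j|A B SA SB i j|A B SA SB i j||A B SA SB|A B SA SB].
- by rewrite mxE; case: (i == j); [apply: (prm_in1 Sf) | apply: (prm_in0 Sf)].
- by rewrite !mxE; apply: (prm_inB Sf).
- rewrite !mxE; apply: (proj1 (prm_sum Sf _)) => k; exact: (prm_inM Sf).
- have -> : (1 : 'M[R]_n) = diag_mx (const_mx 1).
    by apply/matrixP => i j; rewrite !mxE.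
  rewrite blockwise_diag.
  under eq_mxdiag do rewrite mxE (prm1 Sf).
  by rewrite mxdiagZ.
- by rewrite -mxblockB; apply: eq_mxblock => i j; rewrite !mxE (prmB Sf).
- rewrite -!mulmxE /blockwise mul_mxblock; apply: eq_mxblock => i j.
  rewrite !mxE (proj2 (prm_sum Sf _)) => [|k]; last exact: (prm_inM Sf).
  by apply: eq_bigr => k _; rewrite (prmM Sf).
Qed.

End Blockwise.

(** [S] need not be closed under inverses, so [invmx A] is assumed to lie in it; then [f] carries
    [A *m invmx A = 1%:M] to a right inverse of [f A]. *)
Lemma prm_unitmx (E K : fieldType) n m (S : 'M[E]_n -> Prop)
    (f : 'M[E]_n -> 'M[K]_m) A :
  partial_rmorphism S f -> A \in unitmx -> S A -> S (invmx A) ->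
  f A \in unitmx /\ f (invmx A) = invmx (f A).
Proof.
move=> Sf uA SA SV.
have AV : f A *m f (invmx A) = 1%:M.
  by rewrite mulmxE -(prmM Sf) // -mulmxE mulmxV // (prm1 Sf).
have [uf _] := mulmx1_unit AV; split=> //.
by rewrite -[LHS](mulKmx uf) AV mulmx1.
Qed.

Lemma mxrank_mulmx_unit (K : fieldType) n (A P B : 'M[K]_n) :
  A \in unitmx -> B \in unitmx -> \rank (A *m P *m B) = \rank P.
Proof.
move=> uA uB; rewrite mxrankMfree ?row_free_unit //.
by rewrite eqmxMfull ?row_full_unit.
Qed.

Definition rank_entries (E : fieldType) n (A : 'M[E]_n) : seq 'M[E]_n :=
  [:: A; col_ebase A; invmx (col_ebase A); row_ebase A; invmx (row_ebase A)].

(** In the image of the factorization [mulmx_ebase] the outer factors stay invertible, and [pid_mx]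
    becomes block diagonal with [\rank A] identity blocks of size [d]. *)
Lemma mxrank_blockwise (E K : fieldType) d (S : E -> Prop) (f : E -> 'M[K]_d) n
    (A : 'M[E]_n) :
  partial_rmorphism S f ->
  (forall B, B \in rank_entries A -> forall i j, S (B i j)) ->
  \rank (blockwise f A) = (\rank A * d)%N.
Proof.
move=> Sf SA; have SF := blockwise_prm n Sf.
have SC i j : S (col_ebase A i j) by apply: SA; rewrite !inE eqxx ?orbT.
have SCV i j : S (invmx (col_ebase A) i j) by apply: SA; rewrite !inE eqxx ?orbT.
have SR i j : S (row_ebase A i j) by apply: SA; rewrite !inE eqxx ?orbT.
have SRV i j : S (invmx (row_ebase A) i j) by apply: SA; rewrite !inE eqxx ?orbT.
have [uC _] := prm_unitmx SF (col_ebase_unit A) SC SCV.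
have [uR _] := prm_unitmx SF (row_ebase_unit A) SR SRV.
pose v : 'rV[E]_n := \row_i (i < \rank A)%N%:R.
have pidE : pid_mx (\rank A) = diag_mx v.
  by apply/matrixP => i j; rewrite !mxE -val_eqE mulrb; case: eqP.
have Sv i j : S (diag_mx v i j).
  by rewrite -pidE mxE; case: (_ && _); [apply: prm_in1 Sf | apply: prm_in0 Sf].
have SvR i j : S ((diag_mx v *m row_ebase A) i j) by apply: (prm_inM SF).
rewrite -{1}[A](mulmx_ebase A) pidE -mulmxA !mulmxE (prmM SF) //.
rewrite (prmM SF) // mulrA -mulmxE mxrank_mulmx_unit //.
rewrite (blockwise_diag Sf) rank_mxdiag.
rewrite (eq_bigr (fun i : 'I_n => if (i < \rank A)%N then d else 0%N)).
  rewrite -big_mkcond -(big_ord_widen n (fun=> d)) ?rank_leq_row //.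
  by rewrite sum_nat_const card_ord.
move=> i _; rewrite mxE; case: (i < _)%N; first by rewrite (prm1 Sf) mxrank1.
by rewrite (prm0 Sf) mxrank0.
Qed.

(** * Representing finite subsets of a field by matrices *)

(** The condition [0 < d] excludes the zero ring of empty matrices, where ranks carry no
    information. *)
Definition locally_representable (E K : fieldType) :=
  forall s : seq E, exists d (S : E -> Prop) (f : E -> 'M[K]_d),
    [/\ (0 < d)%N, partial_rmorphism S f & forall x, x \in s -> S x].

Lemma prm_comp (R1 R2 R3 : pzRingType) (S : R1 -> Prop) (T : R2 -> Prop)
    (f : R1 -> R2) (g : R2 -> R3) :
  partial_rmorphism S f -> partial_rmorphism T g ->
  partial_rmorphism (fun x => S x /\ T (f x)) (g \o f).
Proof.
move=> Sf Tg; split=> /= [|x y [Sx Tx] [Sy Ty]|x y [Sx Tx] [Sy Ty]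
            ||x y [Sx Tx] [Sy Ty]|x y [Sx Tx] [Sy Ty]].
- by rewrite (prm1 Sf); split; [apply: prm_in1 Sf | apply: prm_in1 Tg].
- by rewrite (prmB Sf) //; split; [apply: (prm_inB Sf) | apply: (prm_inB Tg)].
- by rewrite (prmM Sf) //; split; [apply: (prm_inM Sf) | apply: (prm_inM Tg)].
- by rewrite (prm1 Sf) (prm1 Tg).
- by rewrite (prmB Sf) // (prmB Tg).
- by rewrite (prmM Sf) // (prmM Tg).
Qed.

Definition mx_entries (R : Type) n (A : 'M[R]_n) : seq R :=
  [seq A i j | i <- enum 'I_n, j <- enum 'I_n].

Lemma mem_mx_entries (R : eqType) n (A : 'M[R]_n) i j : A i j \in mx_entries A.
Proof. by apply/allpairsP; exists (i, j); rewrite /= !mem_enum. Qed.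

(** The second morphism [g] is chosen after [f], so that its domain contains all entries of the
    matrices [f x] with [x] in [s]; it is then applied blockwise. *)
Lemma locally_representable_trans (E F K : fieldType) :
  locally_representable E F -> locally_representable F K ->
  locally_representable E K.
Proof.
move=> EF FK s.
have [d [S [f [d0 Sf sS]]]] := EF s.
have [e [T [g [e0 Tg tT]]]] := FK (flatten [seq mx_entries (f x) | x <- s]).
exists (\sum_(i < d) e)%N, (fun x => S x /\ forall i j, T (f x i j)),
  (blockwise g (n:=d) \o f); split.
- by rewrite sum_nat_const card_ord muln_gt0 d0.
- exact: prm_comp Sf (blockwise_prm d Tg).
- move=> x xs; split; first exact: sS.
  move=> i j; apply: tT; apply/flatten_mapP; exists x => //.
  exact: mem_mx_entries.
Qed.

Lemma locally_representable_refl (K : fieldType) : locally_representable K K.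
Proof.
move=> s; exists 1%N, (fun=> True), (fun x => x%:M); split=> //.
by split=> // [x y _ _|x y _ _]; rewrite ?raddfB // scalar_mxM mulmxE.
Qed.

Section RegularRepresentation.
Import VectorInternalTheory.

(** This is the regular representation on row vectors. It is defined on all of [E], so the same
    morphism serves every finite subset. *)
Lemma locally_representable_fieldExt (K : fieldType) (E : fieldExtType K) :
  locally_representable E K.
Proof.
pose f (y : E) := lin1_mx (v2r \o amulr y \o r2v).
have fE y u : u *m f y = v2r (r2v u * y).
  by rewrite mul_rV_lin1 /= lfunE.
move=> s; exists (dim E), (fun=> True), f; split=> //.
  by rewrite -dimvf adim_gt0.
split=> // [|x y _ _|x y _ _]; apply/row_matrixP => i; rewrite ?rowE.
- by rewrite fE mulr1 r2vK mulmx1.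
- by rewrite mulmxBr !fE mulrBr raddfB.
- by rewrite -mulmxE mulmxA !fE v2rK mulrA.
Qed.

End RegularRepresentation.

(** * Simple extensions inside a larger field *)

Section SimpleExtension.
Variables (K L : fieldType) (iota : {rmorphism K -> L}) (x : L).
Local Notation "p ^iota" := (map_poly (GRing.RMorphism.sort iota) p)
  (at level 2, format "p ^iota") : ring_scope.

(** A presentation of [y] as a fraction at [x], in general not unique. Keeping [p] and [q] explicit
    allows them to be evaluated at other points. *)
Definition adjoin_spec (y : L) (p q : {poly K}) :=
  q^iota.[x] != 0 /\ y = p^iota.[x] / q^iota.[x].

Definition adjoin_pred : {pred L} := fun y => `[< exists p q, adjoin_spec y p q >].

Lemma adjoinP y : reflect (exists p q, adjoin_spec y p q) (y \in adjoin_pred).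
Proof. exact: asboolP. Qed.

Lemma adjoin_spec1 : adjoin_spec 1 1 1.
Proof.
by rewrite /adjoin_spec rmorph1 hornerC divr1; split; rewrite ?oner_neq0.
Qed.

Lemma adjoin_specB y z p q r t : adjoin_spec y p q -> adjoin_spec z r t ->
  adjoin_spec (y - z) (p * t - r * q) (q * t).
Proof.
move=> [q0 ->] [t0 ->]; split; rewrite !rmorphM !hornerE ?mulf_neq0 //.
rewrite !rmorphB !rmorphM /= !hornerE /=.
by rewrite -mulNr addf_div // mulNr.
Qed.

Lemma adjoin_specM y z p q r t : adjoin_spec y p q -> adjoin_spec z r t ->
  adjoin_spec (y * z) (p * r) (q * t).
Proof.
move=> [q0 ->] [t0 ->]; split; rewrite !rmorphM !hornerM ?mulf_neq0 //.
by rewrite mulf_div.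
Qed.

Lemma adjoin_divring_closed : divring_closed adjoin_pred.
Proof.
split=> [|y z /adjoinP [p [q yP]] /adjoinP [r [t zP]]
         |y z /adjoinP [p [q yP]] /adjoinP [r [t zP]]]; apply/adjoinP.
- by exists 1, 1; apply: adjoin_spec1.
- by do 2!eexists; apply: adjoin_specB yP zP.
(* If the numerator of [z] vanishes at [x], then [z = 0] and [y / z] is [0] by the convention on
   inverses. *)
- have [r0|r0] := eqVneq r^iota.[x] 0.
    exists 0, 1; case: zP => _ ->.
    split; rewrite ?rmorph1 ?rmorph0 !hornerE ?oner_neq0 ?r0 //.
    by rewrite mul0r invr0 mulr0.
  exists (p * t), (q * r); apply: adjoin_specM => //.
  by case: zP => t0 ->; split=> //; rewrite invf_div.
Qed.

HB.instance Definition _ :=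
  GRing.isDivringClosed.Build L adjoin_pred adjoin_divring_closed.

Record adjoin := Adjoin { adjoin_val : L; _ : adjoin_val \in adjoin_pred }.

HB.instance Definition _ := [isSub for adjoin_val].
HB.instance Definition _ := [Choice of adjoin by <:].
HB.instance Definition _ := [SubChoice_isSubIntegralDomain of adjoin by <:].
HB.instance Definition _ := [SubIntegralDomain_isSubField of adjoin by <:].

(** For [x] transcendental, evaluation at a point [t] of [K] is a morphism on the fractions having a
    denominator nonzero at [t]. A non-root [t] of the product of the chosen denominators of [s] puts
    all of [s] in this local ring, with [d = 1]. *)
Lemma locally_representable_adjoin :
  (forall q : {poly K}, q != 0 -> exists t, q.[t] != 0) ->
  (forall p : {poly K}, p^iota.[x] = 0 -> p = 0) ->
  locally_representable adjoin K.
Proof.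
move=> infK trx s.
have /choice [den denP] (y : adjoin) :
    exists q, exists p, adjoin_spec (val y) p q.
  by have /adjoinP [p [q yP]] := valP y; exists q, p.
have den0 y : den y != 0.
  have [p [q0 _]] := denP y.
  by apply: contra_neq q0 => ->; rewrite rmorph0 horner0.
have [t] : exists t, (\prod_(y <- s) den y).[t] != 0.
  by apply: infK; rewrite prodf_seq_neq0; apply/allP => y _; rewrite den0.
rewrite horner_prod prodf_seq_neq0 => /allP /= dent.
pose good (y : adjoin) p q := adjoin_spec (val y) p q /\ q.[t] != 0.
have /choice [c cP] (y : adjoin) :
    exists c, forall p q, good y p q -> c = p.[t] / q.[t].
  have [[p [q [[q0 yP] qt]]]|no] := pselect (exists p q, good y p q); last first.
    by exists 0 => p q yP; case: no; exists p, q.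
  (* The value at [t] does not depend on the presentation: two presentations of [y] give a
     cross-multiplied equality at [x], which holds between polynomials by [trx], hence at [t]. *)
  exists (p.[t] / q.[t]) => r u [[u0]]; rewrite yP => /eqP.
  rewrite eqr_div // => /eqP e ut.
  apply/eqP; rewrite eqr_div // -!hornerM; apply/eqP; congr _.[t]; apply/eqP.
  rewrite -subr_eq0; apply/eqP/trx.
  by rewrite rmorphB !rmorphM hornerD hornerN !hornerM e subrr.
exists 1%N, (fun y => exists p q, good y p q), (fun y => (c y)%:M).
split=> //; last first.
  move=> y ys; have [p yP] := denP y.
  by exists p, (den y); split=> //; apply: dent.
have good1 : good 1 1 1.
  by split; [apply: adjoin_spec1 | rewrite hornerC oner_neq0].
have goodB y z p q r u : good y p q -> good z r u ->
    good (y - z) (p * u - r * q) (q * u).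
  move=> [yP qt] [zP ut].
  by split; [apply: adjoin_specB | rewrite hornerM mulf_neq0].
have goodM y z p q r u : good y p q -> good z r u ->
    good (y * z) (p * r) (q * u).
  move=> [yP qt] [zP ut].
  by split; [apply: adjoin_specM | rewrite hornerM mulf_neq0].
split=> [|y z [p [q yP]] [r [u zP]]|y z [p [q yP]] [r [u zP]]
        ||y z [p [q yP]] [r [u zP]]|y z [p [q yP]] [r [u zP]]].
- by exists 1, 1.
- by do 2!eexists; apply: goodB yP zP.
- by do 2!eexists; apply: goodM yP zP.
- by rewrite (cP _ _ _ good1) divff // hornerC oner_neq0.
- rewrite (cP _ _ _ (goodB _ _ _ _ _ _ yP zP)) (cP _ _ _ yP) (cP _ _ _ zP).
  rewrite -raddfB.
  rewrite hornerD hornerN !hornerM -[in RHS]mulNr addf_div ?mulNr //.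
    by case: yP.
  by case: zP.
- rewrite (cP _ _ _ (goodM _ _ _ _ _ _ yP zP)) (cP _ _ _ yP) (cP _ _ _ zP).
  by rewrite -mulmxE -scalar_mxM !hornerM mulf_div.
Qed.

Lemma locally_representable_simple_extension :
  (forall q : {poly K}, q != 0 -> exists t, q.[t] != 0) ->
  exists (E : fieldType) (kappa : {rmorphism E -> L}),
    [/\ locally_representable E K, exists e, kappa e = x
      & forall k, exists e, kappa e = iota k].
Proof.
move=> infK.
have [[p [px p0]]|trx] :=
  pselect (exists p : {poly K}, root p^iota x /\ p != 0); last first.
  exists adjoin, (val : {rmorphism adjoin -> L}); split.
  - apply: locally_representable_adjoin => // p /eqP px.
    by apply/eqP/negP => /negP p0; case: trx; exists p.
  - have xP : x \in adjoin_pred.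
      apply/adjoinP; exists 'X, 1; split; rewrite rmorph1 hornerC ?oner_neq0 //.
      by rewrite map_polyX hornerX divr1.
    by exists (Adjoin xP).
  - move=> k; have kP : iota k \in adjoin_pred.
      apply/adjoinP; exists k%:P, 1.
      split; rewrite rmorph1 [(1).[x]]hornerC ?oner_neq0 //.
      by rewrite map_polyC hornerC divr1.
    by exists (Adjoin kP).
(* Algebraic case: a nonzero polynomial of least size with root [x] is irreducible, and the quotient
   by it is a finite extension of [K] that embeds in [L]. *)
have ex_size : exists n,
    `[< exists q : {poly K}, [/\ root q^iota x, q != 0 & size q = n] >].
  by exists (size p); apply/asboolP; exists p.
case: (ex_minnP ex_size) => n /asboolP [m [mx m0 <-]] m_min.
have irr_m : irreducible_poly m.
  apply/(subfx_irreducibleP mx m0) => q qx q0.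
  by apply: m_min; apply/asboolP; exists q.
exists (SubFieldExtType mx irr_m),
  (subfx_inj : {rmorphism SubFieldExtType mx irr_m -> L}); split.
- exact: locally_representable_fieldExt.
- by exists (subfx_root iota x m); apply: subfx_inj_root.
- move=> k; exists (k *: 1 : subFExtend iota x m); exact: subfx_inj_base.
Qed.
End SimpleExtension.

(** * Finitely generated subfields in characteristic zero *)

Section CharacteristicZero.
Variables (L : fieldType) (ratL : {rmorphism rat -> L}).

Lemma natr_inj_of_rmorphism (K : fieldType) (kappa : {rmorphism K -> L}) :
  injective (fun n : nat => n%:R : K).
Proof.
move=> m n /(congr1 kappa); rewrite !rmorph_nat -!(rmorph_nat ratL).
by move/fmorph_inj/eqP; rewrite Num.Theory.eqr_nat => /eqP.
Qed.

(** Otherwise the first [size q] natural numbers, distinct in [K], would all be roots of [q],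
    exceeding its degree. *)
Lemma exists_horner_neq0 (K : fieldType) (kappa : {rmorphism K -> L})
    (q : {poly K}) :
  q != 0 -> exists t, q.[t] != 0.
Proof.
move=> q0; apply: contrapT => no.
have := max_poly_roots q0 (rs := [seq i%:R | i <- iota 0 (size q)]).
rewrite size_map size_iota ltnn => H; suff: false by []; apply: H.
  by apply/allP => t _; rewrite rootE; apply: contraT => qt; case: no; exists t.
by rewrite map_inj_uniq ?iota_uniq //; apply: natr_inj_of_rmorphism kappa.
Qed.

Lemma locally_representable_finitely_generated (s : seq L) :
  exists (K : fieldType) (kappa : {rmorphism K -> L}),
    locally_representable K rat /\ forall y, y \in s -> exists e, kappa e = y.
Proof.
elim: s => [|x s [K [kappa [KQ sP]]]].
  by exists rat, ratL; split=> //; apply: locally_representable_refl.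
have [E [kappa' [EK [e xe] emb]]] :=
  locally_representable_simple_extension kappa x (exists_horner_neq0 kappa).
exists E, kappa'; split; first exact: locally_representable_trans EK KQ.
move=> y; rewrite inE => /predU1P [->|/sP [k <-]]; first by exists e.
exact: emb.
Qed.

Lemma locally_representable_rat : locally_representable L rat.
Proof.
move=> s; have [K [kappa [KQ sP]]] := locally_representable_finitely_generated s.
(* [h] is a left inverse of the embedding [kappa], with irrelevant values outside its image; it
   carries the representation of [K] over to a subring of [L]. *)
have /choice [h hP] (y : L) : exists e, (exists e', kappa e' = y) -> kappa e = y.
  have [[e ye]|no] := pselect (exists e, kappa e = y); first by exists e.
  by exists 0.
have [d [S [f [d0 Sf sS]]]] := KQ [seq h y | y <- s].
have hK e : h (kappa e) = e by apply: (fmorph_inj kappa); apply: hP; exists e.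
exists d, (fun y => exists2 e, kappa e = y & S e), (f \o h).
split=> //; last first.
  move=> y ys; exists (h y); first by apply: hP; apply: sP.
  by apply: sS; apply: map_f.
split=> /= [|_ _ [y <- Sy] [z <- Sz]|_ _ [y <- Sy] [z <- Sz]
           ||_ _ [y <- Sy] [z <- Sz]|_ _ [y <- Sy] [z <- Sz]].
- by exists 1; [rewrite rmorph1 | apply: prm_in1 Sf].
- by exists (y - z); [rewrite rmorphB | apply: (prm_inB Sf)].
- by exists (y * z); [rewrite rmorphM | apply: (prm_inM Sf)].
- by rewrite -[1 in LHS](rmorph1 kappa) hK (prm1 Sf).
- by rewrite -rmorphB !hK (prmB Sf).
- by rewrite -rmorphM !hK (prmM Sf).
Qed.

End CharacteristicZero.

(** * Finite models of matrix-valued maps on a group *)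

Lemma locally_representable_mx (E K : fieldType) n (ms : seq 'M[E]_n) :
  locally_representable E K ->
  exists N (S : 'M[E]_n -> Prop) (f : 'M[E]_n -> 'M[K]_N),
    [/\ (n <= N)%N, partial_rmorphism S f
      & forall A, A \in ms -> S A /\ rho (f A) = rho A].
Proof.
move=> EK.
have [d [S [f [d0 Sf sS]]]] :=
  EK (flatten [seq mx_entries B | B <- flatten [seq rank_entries A | A <- ms]]).
exists (\sum_(i < n) d)%N, (fun A => forall i j, S (A i j)), (blockwise f (n:=n)).
have SB A B i j : A \in ms -> B \in rank_entries A -> S (B i j).
  move=> Ams BA; apply: sS; apply/flatten_mapP; exists B; last exact: mem_mx_entries.
  by apply/flatten_mapP; exists A.
split; [|exact: blockwise_prm|].
- by rewrite sum_nat_const card_ord leq_pmulr.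
- move=> A Ams; split=> [i j|]; first by apply: SB Ams _; rewrite inE eqxx.
  (* Rank and size are both multiplied by [d], which cancels because it is nonzero. *)
  rewrite /rho (mxrank_blockwise Sf) => [|B BA i j]; last exact: SB BA.
  rewrite sum_nat_const card_ord !natrM -mulf_div divff ?mulr1 //.
  by rewrite Num.Theory.pnatr_eq0 -lt0n.
Qed.

Lemma finite_model (E K : fieldType) (G : groupType) n (A : G -> 'M[E]_n)
    (l : seq G) :
  locally_representable E K -> (forall g, A g \in unitmx) ->
  exists N (B : G -> 'M[K]_N),
    [/\ (n <= N)%N, forall g, B g \in unitmx,
        forall g h, g \in l -> h \in l -> (g * h)%g \in l ->
          rho (invmx (B g *m B h) *m B (g * h)%g - 1%:M) =
          rho (invmx (A g *m A h) *m A (g * h)%g - 1%:M)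
      & forall g h, g \in l -> h \in l ->
          rho (invmx (B h) *m B g - 1%:M) = rho (invmx (A h) *m A g - 1%:M)].
Proof.
move=> EK uA.
pose D1 g h := invmx (A g *m A h) *m A (g * h)%g - 1%:M.
pose D2 g h := invmx (A h) *m A g - 1%:M.
(* The matrices and inverses are listed so that [f] commutes with the products and [invmx] in [D1]
   and [D2]; [D1] and [D2] themselves, so that their [rho] is preserved. *)
have [N [S [f [nN Sf fP]]]] := locally_representable_mx
  ([seq A g | g <- l] ++ [seq invmx (A g) | g <- l]
   ++ [seq invmx (A g *m A h) | g <- l, h <- l]
   ++ [seq D1 g h | g <- l, h <- l] ++ [seq D2 g h | g <- l, h <- l]) EK.
have SA g : g \in l -> S (A g).
  by move=> gl; apply: (fP _ _).1; rewrite mem_cat map_f.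
have SV g : g \in l -> S (invmx (A g)).
  move=> gl; apply: (fP _ _).1.
  by rewrite !mem_cat (map_f (fun g => invmx (A g))) ?orbT.
have SMV g h : g \in l -> h \in l -> S (invmx (A g *m A h)).
  move=> gl hl; apply: (fP _ _).1.
  by rewrite !mem_cat (allpairs_f (fun g h => invmx (A g *m A h))) ?orbT.
have fD1 g h : g \in l -> h \in l -> rho (f (D1 g h)) = rho (D1 g h).
  by move=> gl hl; apply: (fP _ _).2; rewrite !mem_cat allpairs_f ?orbT.
have fD2 g h : g \in l -> h \in l -> rho (f (D2 g h)) = rho (D2 g h).
  by move=> gl hl; apply: (fP _ _).2; rewrite !mem_cat allpairs_f ?orbT.
have fVM P Q : P \in unitmx -> S P -> S (invmx P) -> S Q ->
    f (invmx P *m Q - 1%:M) = invmx (f P) *m f Q - 1%:M.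
  move=> uP SP SPV SQ; have [_ <-] := prm_unitmx Sf uP SP SPV.
  rewrite mulmxE (prmB Sf) ?(prmM Sf) ?(prm1 Sf) //; last exact: prm_in1 Sf.
  exact: (prm_inM Sf).
(* Outside [l], where [f (A g)] may fail to be invertible, the identity keeps the values in the
   general linear group. *)
exists N, (fun g => if g \in l then f (A g) else 1%:M); split=> //.
- move=> g; case: ifP => [gl|_]; last by rewrite unitmx1.
  by have [] := prm_unitmx Sf (uA g) (SA g gl) (SV g gl).
- move=> g h gl hl ghl; rewrite gl hl ghl -/(D1 g h) -fD1 // /D1 fVM //; last 1 first.
  + exact: SA.
  + by rewrite [f (A g *m A h)](prmM Sf) //; apply: SA.
  + by rewrite unitmx_mul !uA.
  + by apply: (prm_inM Sf); apply: SA.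
  + exact: SMV.
- move=> g h gl hl; rewrite gl hl -/(D2 g h) -fD2 // /D2 fVM //.
  + exact: SA.
  + exact: SV.
  + exact: SA.
Qed.

(** * Transfer between ultraproducts along the same ultrafilter *)

Lemma ultrafilter_cofinite (U : (nat -> Prop) -> Prop) :
  is_ultrafilter U -> non_principal U -> forall m, U (fun k => (m <= k)%N).
Proof.
move=> [UT _ Usub UI Udec] npU; elim=> [|m IH]; first exact: Usub UT _.
have [Um|Um] := Udec (fun k => k = m); first by case: (npU m).
by apply: Usub (UI _ _ IH Um) _ => k [mk /eqP km]; rewrite ltn_neqAle eq_sym km.
Qed.

(** Index [k] uses a finite model on a list [l k] that grows to exhaust the group. For fixed [g] and
    [h], the relevant elements lie in [l k] for all large [k], a set in [U]; there the [rho] values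
    over [E] and [K] coincide, so the limit conditions transfer in both directions. *)
Lemma embeds_of_locally_representable (E K : fieldType) (G : groupType) :
  locally_representable E K -> countable_type G ->
  embeds_in_metric_ultraproduct E G -> embeds_in_metric_ultraproduct K G.
Proof.
move=> EK [c c_inj] [U [n [A [ultraU npU n_infty [uA morA injA]]]]].
(* Injectivity of [c] leaves at most one new element to add at each step. *)
have /choice [l lP] k : exists l : seq G, forall g, (c g <= k)%N -> g \in l.
  elim: k => [|k [l lP]].
    have [[g cg]|no] := pselect (exists g, c g = 0%N); last first.
      by exists [::] => g; rewrite leqn0 => /eqP cg; case: no; exists g.
    by exists [:: g] => h; rewrite leqn0 -cg => /eqP /c_inj ->; rewrite inE.
  have [[g cg]|no] := pselect (exists g, c g = k.+1); last first.
    exists l => g; rewrite leq_eqVlt => /predU1P [cg|/lP//].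
    by case: no; exists g.
  exists (g :: l) => h; rewrite leq_eqVlt -cg inE.
  by move=> /predU1P [/c_inj ->|]; rewrite ?eqxx // cg => /lP ->; rewrite orbT.
(* The size and the map into matrices of that size are packed into one dependent pair, so that a
   single choice over [k] yields both. *)
have /choice [M MP] k : exists M : {N & G -> 'M[K]_N},
    [/\ (n k <= projT1 M)%N, forall g, projT2 M g \in unitmx,
        forall g h, g \in l k -> h \in l k -> (g * h)%g \in l k ->
          rho (invmx (projT2 M g *m projT2 M h) *m projT2 M (g * h)%g - 1%:M) =
          rho (invmx (A g k *m A h k) *m A (g * h)%g k - 1%:M)
      & forall g h, g \in l k -> h \in l k ->
          rho (invmx (projT2 M h) *m projT2 M g - 1%:M) =
          rho (invmx (A h k) *m A g k - 1%:M)].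
  have [N [B BP]] := finite_model (l k) EK (fun g => uA g k).
  by exists (existT _ N B).
have [_ _ Usub UI _] := ultraU.
have cofin := ultrafilter_cofinite ultraU npU.
exists U, (fun k => projT1 (M k)), (fun g k => projT2 (M k) g); split=> //.
  move=> m; have [k0 k0P] := n_infty m; exists k0 => k kk0.
  by have [nM _ _ _] := MP k; apply: leq_trans (k0P k kk0) nM.
split.
- by move=> g k; have [_ uB _ _] := MP k.
- move=> g h eps eps0.
  apply: Usub (UI _ _ (cofin (maxn (c g) (maxn (c h) (c (g * h)%g))))
                      (morA g h eps eps0)) _.
  move=> k []; rewrite !geq_max => /and3P [cg ch cgh].
  by have [_ _ BP _] := MP k; rewrite BP ?lP.
(* Here the transfer runs backwards: equivalence over [K] gives equivalence over [E], where
   injectivity is known. *)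
- move=> g h equivB; apply: injA => eps eps0.
  apply: Usub (UI _ _ (cofin (maxn (c g) (c h))) (equivB eps eps0)) _.
  move=> k []; rewrite !geq_max => /andP [cg ch].
  by have [_ _ _ BP] := MP k; rewrite BP ?lP.
Qed.

(** * The embedding of the rationals into the complex numbers *)

Section RatToComplex.
Local Notation RR := Rdefinitions.R.

Definition rat_to_complexR (q : rat) : complexR := Cplx (ratr q : RR) (0 : RR).

Lemma rat_to_complexR_zmod : zmod_morphism rat_to_complexR.
Proof.
move=> x y; rewrite /rat_to_complexR rmorphB.
(* The imaginary part is an expression in the operations on [RR]; it is restated up to conversion
   with the ring operations, so that [subrr] applies. *)
by apply: c_ext => //=; rewrite -[RHS]/(0 - 0 : RR) subrr.
Qed.

Lemma rat_to_complexR_monoid : monoid_morphism rat_to_complexR.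
Proof.
split=> [|x y]; first by rewrite /rat_to_complexR rmorph1.
rewrite /rat_to_complexR rmorphM; apply: c_ext => /=.
  by rewrite -[RHS]/(ratr x * ratr y - 0 * 0 : RR) mulr0 subr0.
by rewrite -[RHS]/(ratr x * 0 + 0 * ratr y : RR) mulr0 mul0r addr0.
Qed.

HB.instance Definition _ := GRing.isZmodMorphism.Build rat complexR
  rat_to_complexR rat_to_complexR_zmod.
HB.instance Definition _ := GRing.isMonoidMorphism.Build rat complexR
  rat_to_complexR rat_to_complexR_monoid.

End RatToComplex.

Theorem mainTheorem9 (G : groupType) :
  countable_type G -> linear_sofic G ->
  embeds_in_metric_ultraproduct rat G.
Proof.
apply: embeds_of_locally_representable.
exact: (locally_representable_rat rat_to_complexR).
Qed.
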